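(* Every fence has the Jure property. That is, if $X$ is a fence, then $X$ has a basis consisting of pierced open sets.
   Context: An arc is a space homeomorphic to $[0,1]$. A fence is a compact metric space each of whose connected components is either an arc or a singleton. Let $X$ be a fence and let $U\subset X$ be open. A point $x\in\partial U$ is a piercing point for $U$ if for every open set $V\subset X$ containing $x$, and every arc $\alpha\subset X$ which goes through $x$ (meaning $x\in\alpha$ and $x$ is not an endpoint of $\alpha$), the set $\alpha\cap V$ intersects both $U$ and $X\setminus\overline U$. The open set $U$ is pierced if every point of $\partial U$ is a piercing point for $U$. (Boundaries and closures are taken in $X$.) The space $X$ has the Jure property if $X$ has a basis of pierced open sets. *)

(* Defs.v *)
From HB Require Import structures.
From mathcomp Require Import all_boot all_order all_algebra.
From mathcomp Require Import all_classical all_reals all_analysis.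

Set Implicit Arguments.
Unset Strict Implicit.
Unset Printing Implicit Defensive.

Import Order.TTheory GRing.Theory Num.Theory.
Import numFieldNormedType.Exports.

Local Open Scope classical_set_scope.
Local Open Scope ring_scope.

(* [f] and [g] are total functions, but only the values of [f] on [A] and of
   [g] on [B] matter: [{within A, continuous f}] is continuity of the
   restriction of [f] to [A] for the subspace topology. *)
Definition homeomorphism_on (S T : topologicalType) (A : set S) (B : set T)
    (f : S -> T) : Prop :=
  [/\ set_bij A B f, {within A, continuous f} &
      exists2 g : T -> S, {in A, cancel f g} & {within B, continuous g}].

Definition is_arc (R : realType) (X : topologicalType) (A : set X) : Prop :=
  exists f : R -> X, homeomorphism_on (`[0, 1] : set R) A f.

Definition arc_endpoint (R : realType) (X : topologicalType) (A : set X)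
    (x : X) : Prop :=
  exists2 f : R -> X, homeomorphism_on (`[0, 1] : set R) A f & x = f 0 \/ x = f 1.

Definition is_fence (R : realType) (X : metricType R) : Prop :=
  compact [set: X] /\
  forall x : X, is_arc R (connected_component [set: X] x) \/
    exists y : X, connected_component [set: X] x = [set y].

Definition boundary (X : topologicalType) (U : set X) : set X :=
  closure U `\` interior U.

Definition goes_through (R : realType) (X : topologicalType) (A : set X)
    (x : X) : Prop :=
  A x /\ ~ arc_endpoint R A x.

Definition piercing_point (R : realType) (X : topologicalType) (U : set X)
    (x : X) : Prop :=
  boundary U x /\
  forall V : set X, open V -> V x ->
  forall A : set X, is_arc R A -> goes_through R A x ->
    (A `&` V) `&` U !=set0 /\ (A `&` V) `&` ~` closure U !=set0.

Definition pierced (R : realType) (X : topologicalType) (U : set X) : Prop :=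
  open U /\ forall x : X, boundary U x -> piercing_point R U x.

Definition jure_property (R : realType) (X : topologicalType) : Prop :=
  exists2 B : set (set X), basis B & forall U : set X, B U -> pierced R U.

(* Main.v *)
Require Import Defs.
From mathcomp Require Import all_boot all_order all_algebra.
From mathcomp Require Import all_classical all_reals all_analysis.
From mathcomp Require Import zify lra.

(** Only interior points of arcs are constrained, and the boundary of the wanted
    open set [U] may contain whole pieces of the space that no arc crosses.  So
    [U] and the exterior [O] are grown together, as unions of increasing
    sequences of open sets [P_n] and [Q_n] that stay at a positive distance
    from each other, starting from a point [x] and the complement of a ball
    around it.  A boundary point of [U] lies in no [P_n] and in no [Q_n], hence
    [U] is pierced as soon as, at stage [n], every arc of size about [1/n]
    through a point not yet decided meets both [P_n] and [Q_n].  This need not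
    hold for smaller arcs, which are left to later stages; that is what makes a
    single stage possible even when arcs fold near other arcs at every scale.

    The stage [refine_far_apart] transports the problem to the real line.  For
    every [e > 0] a fence has a continuous map [f] to the line whose fibres have
    diameter at most [e], even with a margin: [f y] close to [f z] forces
    [mdist y z < e] ([fence_fine_map]).  Near one component this is a Tietze
    extension of a coordinate of the arc, which stays fine on a clopen
    neighbourhood of the component because in a compact space components are
    intersections of clopen sets ([component_quasicomponent]); compactness and
    disjoint translates glue these local maps.  On the line, sets at distance
    [r] are enlarged to open sets such that every remaining point has both of
    them within [r] ([separate_on_line]), by colouring the nodes of a grid with
    two colours.  Preimages under [f] give the next pair: an arc of size [e] on
    both sides of [x] is mapped over a full neighbourhood of radius [r] of
    [f x] ([fine_map_spans]).

    The size of an arc around [x] is recorded by [spans]: the arc is a union of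
    connected sets [L] and [M] through [x], each having a point at distance at
    least [e] from the other.  A folded arc whose two halves run close to each
    other is thus small, as it has to be, since [f] cannot tell the halves
    apart. *)

Import Order.TTheory GRing.Theory Num.Theory.
Import numFieldNormedType.Exports.
Local Open Scope classical_set_scope.
Local Open Scope ring_scope.

(** * Separation on the real line *)

(** The nodes are the multiples of [h]; an open interval of radius [h / 3] is put
    around each node of [K], and cells with both ends in [K] are filled.  The
    case [k = l] gives the former, [l = k + 1] the latter. *)
Definition band {R : realType} (h : R) (K : set int) : set R :=
  [set y | exists k l : int, [/\ K k, K l, k <= l <= k + 1 &
    k%:~R * h - h / 3 < y < l%:~R * h + h / 3]].

Lemma open_band {R : realType} (h : R) (K : set int) : open (band h K).
Proof.
suff -> : band h K = \bigcup_(kl in [set kl : int * int |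
    [/\ K kl.1, K kl.2 & kl.1 <= kl.2 <= kl.1 + 1]])
    `]kl.1%:~R * h - h / 3, kl.2%:~R * h + h / 3[%classic.
  by apply: bigcup_open => kl _; exact: itv_open.
apply/seteqP; split=> [y [k [l [Kk Kl kl ykl]]]|y [[k l] [Kk Kl kl]]].
  by exists (k, l) => //=; rewrite in_itv.
by rewrite /= in_itv /= => ykl; exists k, l.
Qed.

Lemma grid_step {R : realType} (h : R) (k l : int) :
  0 <= h -> k + 1 <= l -> k%:~R * h + h <= l%:~R * h.
Proof.
move=> h0 kl; have : (k + 1)%:~R * h <= l%:~R * h by rewrite ler_wpM2r// ler_int.
by rewrite intrD mulrDl mul1r.
Qed.

Lemma bandC_far {R : realType} (h : R) (K : set int) (p q : R) :
  0 < h -> band h K p -> band h (~` K) q -> h / 3 <= `|p - q|.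
Proof.
move=> h0 [k [l [Kk Kl kl pkl]]] [k' [l' [Kk' Kl' kl' qkl']]].
have neq i j : K i -> (~` K) j -> i <> j by move=> Ki Kj ij; apply: Kj; rewrite -ij.
have [lk'|lk'] := ltP l k'.
  have := @grid_step _ _ l k' (ltW h0); rewrite lezD1 => /(_ lk') ?.
  by rewrite ler_normr; apply/orP; right; lra.
have l'l : l' + 1 <= l.
  have := neq _ _ Kl Kl'; have := neq _ _ Kl Kk'; lia.
have l'k : l' + 1 <= k.
  by have := neq _ _ Kk Kl'; lia.
have := @grid_step _ _ l' k (ltW h0) l'k => ?.
by rewrite ler_normr; apply/orP; left; lra.
Qed.

Lemma grid_floor {R : realType} (h y : R) : 0 < h ->
  exists k : int, k%:~R * h <= y < (k + 1)%:~R * h.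
Proof.
move=> h0; exists (Num.floor (y / h)).
by rewrite -ler_pdivlMr// -ltr_pdivrMr// floor_le_tmp floorD1_gt.
Qed.

(** With mesh [r / 3], the nodes next to [S] and those next to [T] are different,
    so one colour can be used near [S] and the other elsewhere.  A point in
    neither band lies in a cell whose two ends have different colours. *)
Lemma separate_on_line {R : realType} (r : R) (S T : set R) : 0 < r ->
  (forall s t, S s -> T t -> r <= `|s - t|) ->
  exists P Q : set R, [/\ open P, open Q, S `<=` P, T `<=` Q &
    (exists2 d, 0 < d & forall p q, P p -> Q q -> d <= `|p - q|) /\
    forall y, ~ P y -> ~ Q y ->
      (exists2 p, P p & `|p - y| < r) /\ (exists2 q, Q q & `|q - y| < r)].
Proof.
move=> r0 rST; pose h := r / 3; have h0 : 0 < h by rewrite divr_gt0.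
pose K : set int := [set k | exists2 s, S s & `|s - k%:~R * h| <= h].
have node (L : set int) k : L k -> band h L (k%:~R * h).
  by move=> Lk; exists k, k; split=> //; [rewrite lexx /= lerDl|apply/andP; split; lra].
have cell (L : set int) k y : L k -> L (k + 1) ->
    k%:~R * h <= y < (k + 1)%:~R * h -> band h L y.
  move=> Lk Lk1 ky; exists k, (k + 1); split=> //; first by rewrite lerDl/= lexx.
  by apply/andP; split; lra.
have near_node k y : k%:~R * h <= y < (k + 1)%:~R * h ->
    `|y - k%:~R * h| <= h /\ `|y - (k + 1)%:~R * h| <= h.
  by rewrite intrD mulrDl mul1r => ky; split; rewrite ler_norml; apply/andP; split; lra.
exists (band h K), (band h (~` K)); split; [exact: open_band|exact: open_band| | |].
- move=> s Ss; have [k ks] := grid_floor h s h0; have [sk sk1] := near_node _ _ ks.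
  by apply: cell ks; exists s.
- move=> t Tt; have [k kt] := grid_floor h t h0; have [tk tk1] := near_node _ _ kt.
  have notK j : `|t - j%:~R * h| <= h -> (~` K) j.
    move=> tj [s Ss sj]; have := rST _ _ Ss Tt.
    have := ler_distD (j%:~R * h) s t; rewrite (distrC (j%:~R * h) t).
    have -> : r = 3 * h by rewrite /h; lra.
    by lra.
  by apply: cell kt; exact: notK.
- split; first by exists (h / 3); [lra|move=> p q; exact: bandC_far].
  move=> y Py Qy; have [k ky] := grid_floor h y h0; have [yk yk1] := near_node _ _ ky.
  have hr : h < r by rewrite /h; lra.
  have [Kk|Kk] := pselect (K k); have [Kk1|Kk1] := pselect (K (k + 1)).
  + by exfalso; apply: Py; exact: cell ky.
  + split; [exists (k%:~R * h)|exists ((k + 1)%:~R * h)]; try exact: node;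
      by rewrite distrC; lra.
  + split; [exists ((k + 1)%:~R * h)|exists (k%:~R * h)]; try exact: node;
      by rewrite distrC; lra.
  + by exfalso; apply: Qy; exact: cell ky.
Qed.

(** * Compactness arguments *)

Lemma compact_near_forall {T : topologicalType} {I : Type} (F : set_system I)
    {FF : Filter F} (P : I -> T -> Prop) : compact [set: T] ->
  (forall x : T, \forall x' \near x & i \near F, P i x') ->
  \forall i \near F, forall x, P i x.
Proof.
move=> /compact_near_coveringP cT locP.
by have := cT I F P FF (fun x _ => locP x); apply: filterS => i Pi x; exact: Pi.
Qed.

Lemma near_mdist {R : realType} {X : metricType R} (x : X) (e : R) : 0 < e ->
  \forall y \near x, mdist x y < e.
Proof. by move=> e0; have := nbhsx_ballx x e e0; rewrite ballEmdist. Qed.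

Lemma compact_unif_cts {R : realType} {X : metricType R} (f : X -> R) (e : R) :
  compact [set: X] -> continuous f -> 0 < e ->
  exists2 d, 0 < d & forall y z, mdist y z < d -> `|f y - f z| < e.
Proof.
move=> cX cf e0.
have near_f x : \forall y \near x, `|f x - f y| < e / 2.
  by have /cvgrPdist_lt := cf x; apply; rewrite divr_gt0.
have near_d : \forall d \near 0^'+, forall y z, mdist y z < d -> `|f y - f z| < e.
  apply: (compact_near_forall _
    (fun d y => forall z, mdist y z < d -> `|f y - f z| < e)) => // x.
  have /nbhs_ballP[r /= r0 xr] := near_f x.
  exists ([set y | mdist x y < r / 2], [set d | d < r / 2]) => /=.
    split; first by apply: near_mdist; rewrite divr_gt0.
    by apply: nbhs_right_lt; rewrite divr_gt0.
  move=> [y d] /= [xy dr] z yz.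
  have xrE u : mdist x u < r -> `|f x - f u| < e / 2.
    by move=> xu; apply: xr; rewrite ballEmdist.
  have fxy : `|f x - f y| < e / 2 by apply: xrE; lra.
  have fxz : `|f x - f z| < e / 2 by apply: xrE; have := metric_triangle x y z; lra.
  by have := ler_distD (f x) (f y) (f z); rewrite (distrC (f y) (f x)); lra.
have [d [Pd d0]] := filter_ex (filterI near_d (nbhs_right_gt (0 : R))).
by exists d.
Qed.

(** * Components and clopen sets *)

(** The index filter for compactness arguments over the clopen sets containing
    [x]; the members [M] are required to be clopen themselves so that a property
    that holds near the filter holds at some clopen set. *)
Definition clopen_nbhs_system {X : topologicalType} (x : X) : set_system (set X) :=
  filter_from [set N | clopen N /\ N x]
    (fun N => [set M | [/\ clopen M, M x & M `<=` N]]).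

#[local] Instance clopen_nbhs_filter {X : topologicalType} (x : X) :
  Filter (clopen_nbhs_system x).
Proof.
apply: filter_from_filter; first by exists setT; split=> //; exact: clopenT.
move=> N N' [cN Nx] [cN' N'x]; exists (N `&` N').
  by split; [exact: clopenI|split].
by move=> M [cM Mx MNN']; split; split=> // y /MNN'[].
Qed.

Lemma near_clopen {X : topologicalType} (x : X) (N : set X) : clopen N -> N x ->
  \forall M \near clopen_nbhs_system x, M `<=` N.
Proof. by move=> cN Nx; exists N => // M []. Qed.

Lemma near_clopen_ex {X : topologicalType} (x : X) (P : set X -> Prop) :
  (\forall M \near clopen_nbhs_system x, P M) ->
  exists N, [/\ clopen N, N x & P N].
Proof. by move=> [N [cN Nx] NP]; exists N; split=> //; apply: NP; split. Qed.

(** The intersection [Q] of the clopen sets containing [x] is connected: were it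
    cut into two closed pieces, disjoint open sets [G] and [H] around the pieces
    would by compactness cover a whole clopen set [N] containing [x], and then
    [N `&` G] would be a clopen set containing [x] but not [Q]. *)
Lemma component_quasicomponent {R : realType} {X : pseudoMetricType R} (x y : X) :
  compact [set: X] ->
  (forall N, clopen N -> N x -> N y) -> connected_component [set: X] x y.
Proof.
move=> cX Ny.
pose Q := \bigcap_(N in [set N | clopen N /\ N x]) N.
have Qx : Q x by move=> N [].
exists Q; last by move=> N [cN Nx]; exact: Ny.
split=> //; apply: contrapT => /connectedPn[E [E0 QE [sE1 sE2]]].
have clQ : closed Q by apply: closed_bigI => N [[]].
have clE b : closed (E b).
  rewrite closure_id; apply/seteqP; split; first exact: subset_closure.
  move=> z Ez; have : Q z.
    by apply: clQ; apply: closureS Ez => u; rewrite QE; case: (b); [right|left].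
  rewrite QE; case: b Ez => Ez [] // Ez'; exfalso.
    by have : set0 z by rewrite -sE2.
  by have : set0 z by rewrite -sE1.
have EI0 b : E b `&` E (~~ b) = set0.
  rewrite -subset0 => z [Ebz Ebz']; rewrite -sE1.
  by case: b Ebz Ebz' => ? ?; split=> //; exact: subset_closure.
have [b Ebx] : exists b, E b x.
  by move: Qx; rewrite QE => -[]; [exists false|exists true].
have [G [H [oG oH EG EH GH]]] :=
  (@normal_openP R X).1 pseudometric_normal _ _ (clE b) (clE (~~ b)) (EI0 b).
have /near_clopen_ex[N [[oN clN] Nx NGH]] :
    \forall N \near clopen_nbhs_system x, N `<=` G `|` H.
  apply: (compact_near_forall _ (fun N z => N z -> (G `|` H) z)) => // z.
  have [[N [[oN clN] Nx] Nz]|Qz] := pselect (exists2 N, clopen N /\ N x & ~ N z).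
    exists (~` N, [set M | M `<=` N]) => /=.
      split; last exact: near_clopen.
      by apply: open_nbhs_nbhs; split=> //; exact: closed_openC.
    by move=> [u M] /= [Nu MN] /MN.
  exists (G `|` H, setT) => /=; last by move=> [u M] [].
  split; last exact: filterT.
  apply: open_nbhs_nbhs; split; first exact: openU.
  have : Q z by move=> N Nx; apply: contrapT => Nz; apply: Qz; exists N.
  rewrite QE; case: (b) EG EH => EG EH [Ez|Ez]; by [right; apply: EH|left; apply: EG].
have cNG : clopen (N `&` G).
  split; first exact: openI.
  suff -> : N `&` G = N `&` ~` H by apply: closedI => //; exact: open_closedC.
  apply/seteqP; split=> z [Nz Gz]; split=> //.
    by move=> Hz; have : set0 z by rewrite -GH.
  by have [] := NGH _ Nz.
have [z Ez] := E0 (~~ b).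
have : (N `&` G) z.
  have : Q z by rewrite QE; case: (b) Ez => /=; [left|right].
  by apply; split=> //; split=> //; exact: EG.
by move=> [_ Gz]; have : set0 z; [rewrite -GH; split=> //; exact: EH|].
Qed.

(** * Maps to the line with small fibres *)

(** [f] is an [e]-map on [N]: its fibres in [N] have diameter at most [e].  The
    uniform margin [r] is part of the definition so that the property can be
    used on the line, where sets are separated by distances. *)
Definition fine_on {R : realType} {X : metricType R} (e : R) (N : set X)
    (f : X -> R) : Prop :=
  exists2 r, 0 < r &
    forall y z, N y -> N z -> `|f y - f z| < r -> mdist y z < e.

(** Fineness on a clopen neighbourhood follows from injectivity on the component
    by compactness of [X * X]: a pair with a point outside the component is
    excluded by a small clopen set, a pair on the diagonal is close, and for any
    other pair the values of [f] differ. *)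
Lemma fine_near_component {R : realType} {X : metricType R} (e : R) (x : X)
    (f : X -> R) : compact [set: X] -> continuous f -> 0 < e ->
  (forall y z, connected_component [set: X] x y ->
    connected_component [set: X] x z -> f y = f z -> y = z) ->
  exists N, [/\ clopen N, N x & fine_on e N f].
Proof.
move=> cX cf e0 finj.
pose ok (Nr : set X * R) (yz : X * X) :=
  Nr.1 yz.1 -> Nr.1 yz.2 -> `|f yz.1 - f yz.2| < Nr.2 -> mdist yz.1 yz.2 < e.
have cXX : compact [set: X * X] by rewrite -setXTT; exact: compact_setX.
have far y : ~ connected_component [set: X] x y ->
    \forall y' \near y & N \near clopen_nbhs_system x, ~ N y'.
  move=> xy; have [N [[oN cN] Nx] Ny] : exists2 N, clopen N /\ N x & ~ N y.
    apply: contrapT => noN; apply: xy; apply: component_quasicomponent => // N cN Nx.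
    by apply: contrapT => Ny; apply: noN; exists N.
  exists (~` N, [set M | M `<=` N]) => /=.
    split; last exact: near_clopen.
    by apply: open_nbhs_nbhs; split=> //; exact: closed_openC.
  by move=> [u M] /= [Nu MN] /MN.
have [[F G] /= [FF GG] FGok] : \forall Nr \near filter_prod (clopen_nbhs_system x) 0^'+,
    forall yz, ok Nr yz.
  apply: compact_near_forall => // -[y z].
  have reduce U V W s : nbhs y U -> nbhs z V -> clopen_nbhs_system x W ->
      (\forall r \near 0^'+, s r) ->
      (forall y' z' N r, U y' -> V z' -> W N -> s r -> ok (N, r) (y', z')) ->
      \forall yz \near (y, z) & Nr \near filter_prod (clopen_nbhs_system x) 0^'+,
        ok Nr yz.
    move=> Uy Vz FW Gs UVok; exists (U `*` V, W `*` s) => /=.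
      by split; [exists (U, V)|exists (W, s)].
    by move=> [[y' z'] [N r]] /= [[Uy' Vz'] [WN sr]]; exact: UVok.
  have triv : \forall r \near (0 : R)^'+, True by exact: filterT.
  have [xy|/far[[U W] [/= Uy FW] UW]] := pselect (connected_component [set: X] x y); last first.
    apply: (reduce U setT W setT) => //; first exact: filterT.
    by move=> y' z' N r Uy' _ WN _ /= Ny'; case: (UW (y', N)).
  have [xz|/far[[V W] [/= Vz FW] VW]] := pselect (connected_component [set: X] x z); last first.
    apply: (reduce setT V W setT) => //; first exact: filterT.
    by move=> y' z' N r _ Vz' WN _ /= _ Nz'; case: (VW (z', N)).
  have [yz|yz] := eqVneq y z.
    apply: (reduce [set u | mdist y u < e / 2] [set u | mdist y u < e / 2] setT setT) => //.
    - by apply: near_mdist; rewrite divr_gt0.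
    - by rewrite -yz; apply: near_mdist; rewrite divr_gt0.
    - exact: filterT.
    move=> y' z' N r /= yy' yz' _ _ _ _ _.
    by have := metric_triangle y' y z'; rewrite (metric_sym y' y); lra.
  have fyz : 0 < `|f y - f z| / 3.
    rewrite divr_gt0// normr_gt0 subr_eq0; apply: contra_neq yz; exact: finj.
  apply: (reduce [set u | `|f y - f u| < `|f y - f z| / 3]
    [set u | `|f z - f u| < `|f y - f z| / 3] setT [set r | r < `|f y - f z| / 3]) => //.
  - by have /cvgrPdist_lt := cf y; exact.
  - by have /cvgrPdist_lt := cf z; exact.
  - exact: filterT.
  - exact: nbhs_right_lt.
  move=> y' z' N r /= yy' zz' _ rs _ _ /= fr; exfalso.
  have := ler_distD (f y') (f y) (f z); have := ler_distD (f z') (f y') (f z).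
  by rewrite (distrC (f z')); lra.
have [r [r0 Gr]] : exists r, 0 < r /\ G r.
  have [r [Gr r0]] : exists r, (G `&` [set r | 0 < r]) r.
    by apply: (@filter_ex _ (0 : R)^'+); apply: filterI => //; exact: nbhs_right_gt.
  by exists r.
have [N [cN Nx FN]] := near_clopen_ex _ _ FF.
exists N; split=> //; exists r => // y z Ny Nz.
by apply: (FGok (N, r) _ (y, z)).
Qed.

Lemma fine_on_setU {R : realType} {X : metricType R} (e M : R) (N N' : set X)
    (f g : X -> R) : clopen N ->
  continuous f -> continuous g ->
  (forall y, `|f y| <= M) -> (forall y, `|g y| <= M) ->
  fine_on e N f -> fine_on e N' g ->
  exists h, [/\ continuous h, forall y, `|h y| <= 3 * M + 1 & fine_on e (N `|` N') h].
Proof.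
move=> [oN cN] cf cg fM gM [r r0 fr] [s s0 gs].
(* The shift makes the values of [f] and of [h] outside [N] at least 1 apart. *)
pose h y := if `[< N y >] then f y else g y + 2 * M + 1.
have hN y : N y -> h y = f y by move=> Ny; rewrite /h asboolT.
have hN' y : ~ N y -> h y = g y + 2 * M + 1 by move=> Ny; rewrite /h asboolF.
exists h; split.
- move=> y; have [Ny|Ny] := pselect (N y).
    rewrite /continuous_at (hN _ Ny); apply: cvg_trans (cf y).
    apply: near_eq_cvg; have : nbhs y N by exact: open_nbhs_nbhs.
    by apply: filterS => z /hN.
  rewrite /continuous_at (hN' _ Ny).
  have : g z + 2 * M + 1 @[z --> y] --> g y + 2 * M + 1.
    by do 2 (apply: cvgD; last exact: cvg_cst); exact: cg.
  apply: cvg_trans; apply: near_eq_cvg.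
  have : nbhs y (~` N) by apply: open_nbhs_nbhs; split=> //; exact: closed_openC.
  by apply: filterS => z /hN'.
- move=> y; have := fM y; have := gM y; rewrite !ler_norml => gy fy.
  by have [/hN->|/hN'->] := pselect (N y); lra.
exists (Num.min (Num.min r s) 1); first by rewrite !lt_min r0 s0/=.
move=> y z NN'y NN'z; rewrite !lt_min -andbA => /and3P[hr hs h1].
have := fM y; have := gM y; have := fM z; have := gM z; rewrite !ler_norml => gz fz gy fy.
have [Ny|Ny] := pselect (N y); have [Nz|Nz] := pselect (N z).
- by apply: fr => //; rewrite -!hN.
- by exfalso; move: h1; rewrite (hN _ Ny) (hN' _ Nz) ltr_norml; lra.
- by exfalso; move: h1; rewrite (hN' _ Ny) (hN _ Nz) ltr_norml; lra.
- case: NN'y => // N'y; case: NN'z => // N'z; apply: gs => //.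
  by move: hs; rewrite (hN' _ Ny) (hN' _ Nz); congr (`|_| < _); lra.
Qed.

Lemma fine_map_of_local {R : realType} {X : metricType R} (e : R) :
  compact [set: X] ->
  (forall x : X, exists N f, [/\ clopen N, N x, continuous f,
    forall y, `|f y| <= 1 & fine_on e N f]) ->
  exists2 f : X -> R, continuous f & fine_on e [set: X] f.
Proof.
move=> cX /choice[N NP].
(* The clopen sets carrying a bounded fine map are directed under inclusion, so
   compactness produces a single one that contains every point. *)
pose good (C : set X) := clopen C /\ exists (f : X -> R) (M : R),
  [/\ continuous f, forall y, `|f y| <= M & fine_on e C f].
have goodU C D : good C -> good D -> good (C `|` D).
  move=> [cC [f [M [cf fM fC]]]] [cD [g [M' [cg gM gD]]]].
  have fMM y : `|f y| <= Num.max M M' by rewrite le_max fM.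
  have gMM y : `|g y| <= Num.max M M' by rewrite le_max gM orbT.
  have [h [ch hM hCD]] := fine_on_setU _ _ _ _ _ _ cC cf cg fMM gMM fC gD.
  by split; [exact: clopenU|exists h, (3 * Num.max M M' + 1)].
have good0 : good set0.
  split; first exact: clopen0.
  exists (cst 0), 0; split; [by move=> y; exact: cst_continuous| |by exists 1].
  by move=> y; rewrite /= normr0.
pose F := filter_from good (fun C => [set D | good D /\ C `<=` D]).
have FF : Filter F.
  apply: filter_from_filter; first by exists set0.
  move=> C D gC gD; exists (C `|` D); first exact: goodU.
  by move=> E [gE CDE]; split; split=> // y Cy; apply: CDE; [left|right].
have coverF : \forall C \near F, forall x, C x.
  apply: (compact_near_forall _ (fun C x => C x)) => // x.
  have [f [cN Nx cf f1 fN]] := NP x.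
  exists (N x, [set D | N x `<=` D]) => /=; last by move=> [y D] [/= Ny]; exact.
  split; first by apply: open_nbhs_nbhs; split=> //; exact: cN.1.
  by exists (N x) => [|D []//]; split=> //; exists f, 1.
have [C gC CF] := coverF.
have CT y : C y by apply: CF; split.
have [_ [f [M [cf _ [r r0 fC]]]]] := gC.
by exists f => //; exists r => // y z _ _; apply: fC.
Qed.

(** On an arc component the inverse of a parametrization is injective and extends
    to the whole space by the Tietze theorem; on a singleton any map is
    injective. *)
Lemma fence_fine_map {R : realType} {X : metricType R} (e : R) :
  is_fence X -> 0 < e ->
  exists2 f : X -> R, continuous f & fine_on e [set: X] f.
Proof.
move=> [cX comp] e0; apply: fine_map_of_local => // x.
have [[u [[uA _ usurj] cu [g gu cg]]]|[y xy]] := comp x; last first.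
  have [||N [cN Nx fN]] := fine_near_component e x (cst 0) cX _ e0.
  - by move=> z; exact: cst_continuous.
  - by rewrite xy => z z' -> ->.
  exists N, (cst 0); split=> //; first by move=> z; exact: cst_continuous.
  by move=> z; rewrite /= normr0.
have gA z : connected_component [set: X] x z -> 0 <= g z <= 1 /\ u (g z) = z.
  by move=> /usurj[t t01 <-]; rewrite gu ?inE//; move: t01; rewrite /= in_itv.
have [|||f [fg cf f1]] := @continuous_bounded_extension X R pseudometric_normal
  (connected_component [set: X] x) _ g 1 _ cg.
- by apply: component_closed; exact: closedT.
- by [].
- by move=> z /gA[z01 _]; rewrite ler_norml; lra.
have [|N [cN Nx fN]] := fine_near_component e x f cX cf e0.
  move=> y z xy xz; rewrite -!fg ?inE// => gyz.
  by rewrite -(gA y xy).2 gyz (gA z xz).2.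
by exists N, f.
Qed.

(** * One stage of the construction *)

Definition far_apart {R : realType} {X : metricType R} (r : R) (P Q : set X) :=
  forall p q, P p -> Q q -> r <= mdist p q.

(** Distances to the opposite set, not diameters, measure the size: they pass
    through an [e]-map [f], because [f a] then stays away from all of [f @` M]. *)
Definition spans {R : realType} {X : metricType R} (e : R) (L M : set X) (x : X) :=
  [/\ connected L, connected M, L x, M x & exists a b,
    [/\ L a, M b, forall m, M m -> e <= mdist a m & forall l, L l -> e <= mdist b l]].

Lemma connected_ivt {R : realType} {X : topologicalType} (f : X -> R) (L : set X)
    (u v : X) (p : R) : continuous f -> connected L -> L u -> L v ->
  f u <= p <= f v -> exists2 w, L w & f w = p.
Proof.
move=> cf cL Lu Lv upv.
have : is_interval (f @` L).
  apply/connected_intervalP/connected_continuous_connected => //.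
  exact: continuous_subspaceT.
by move=> /(_ (f u) (f v)); apply.
Qed.

(** The value [f a] avoids the interval [f @` M], which contains [f x] and [f b],
    and symmetrically for [f b]; hence [f x] separates [f a] from [f b], and both
    are at distance at least [r] from it.  Connectedness does the rest. *)
Lemma fine_map_spans {R : realType} {X : metricType R} (e r : R) (f : X -> R)
    (L M : set X) (x : X) (p : R) : continuous f -> 0 < r ->
  (forall y z, `|f y - f z| < r -> mdist y z < e) ->
  spans e L M x -> `|p - f x| < r -> exists2 w, (L `|` M) w & f w = p.
Proof.
move=> cf r0 fr [cL cM Lx Mx [a [b [La Mb aM bL]]]].
rewrite ltr_norml => px.
have sep y z : e <= mdist y z -> r <= `|f y - f z|.
  by move=> yz; rewrite leNgt; apply/negP => /fr; rewrite ltNge yz.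
have aNM u v : M u -> M v -> ~ (f u <= f a <= f v).
  move=> Mu Mv /(connected_ivt f M u v _ cf cM Mu Mv)[m Mm fm].
  by have := sep _ _ (aM m Mm); rewrite fm subrr normr0; lra.
have bNL u v : L u -> L v -> ~ (f u <= f b <= f v).
  move=> Lu Lv /(connected_ivt f L u v _ cf cL Lu Lv)[l Ll fl].
  by have := sep _ _ (bL l Ll); rewrite fl subrr normr0; lra.
have inL u v : L u -> L v -> f u <= p <= f v -> exists2 w, (L `|` M) w & f w = p.
  by move=> Lu Lv /(connected_ivt f L u v p cf cL Lu Lv)[w Lw <-]; exists w => //; left.
have inM u v : M u -> M v -> f u <= p <= f v -> exists2 w, (L `|` M) w & f w = p.
  by move=> Mu Mv /(connected_ivt f M u v p cf cM Mu Mv)[w Mw <-]; exists w => //; right.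
have ax := sep _ _ (aM x Mx); have bx := sep _ _ (bL x Lx).
have [ab|ba] := lerP (f a) (f b).
  have fax : f a <= f x.
    by rewrite leNgt; apply/negP => xa; apply: (aNM x b) => //; lra.
  have fxb : f x <= f b.
    by rewrite leNgt; apply/negP => bx'; apply: (bNL a x) => //; lra.
  move: ax bx; rewrite ler0_norm ?subr_le0// ger0_norm ?subr_ge0// => ax bx.
  by have [xp|xp] := lerP (f x) p; [apply: (inM x b)|apply: (inL a x)] => //; lra.
have fbx : f b <= f x.
  by rewrite leNgt; apply/negP => xb; apply: (bNL x a) => //; lra.
have fxa : f x <= f a.
  by rewrite leNgt; apply/negP => ax'; apply: (aNM b x) => //; lra.
move: ax bx; rewrite ger0_norm ?subr_ge0// ler0_norm ?subr_le0// => ax bx.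
by have [xp|xp] := lerP (f x) p; [apply: (inL x a)|apply: (inM b x)] => //; lra.
Qed.

(** Taking [f] finer than [r] keeps the images of [P] and [Q] apart on the line;
    taking it finer than [e] makes the sets in [spans e L M x] cross there. *)
Lemma refine_far_apart {R : realType} {X : metricType R} (e r : R) (P Q : set X) :
  is_fence X -> 0 < e -> 0 < r -> far_apart r P Q ->
  exists P' Q' : set X, [/\ open P' /\ open Q', P `<=` P', Q `<=` Q',
    exists2 r', 0 < r' & far_apart r' P' Q' &
    forall L M x, spans e L M x -> ~ P' x -> ~ Q' x ->
      (L `|` M) `&` P' !=set0 /\ (L `|` M) `&` Q' !=set0].
Proof.
move=> fX e0 r0 PQ.
have er0 : 0 < Num.min e r by rewrite lt_min e0.
have [f cf [s s0 fs]] := fence_fine_map _ fX er0.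
have [|A [B [oA oB PA QB [[d d0 AB] near_AB]]]] :=
  separate_on_line s (f @` P) (f @` Q) s0.
  move=> _ _ [p Pp <-] [q Qq <-]; rewrite leNgt; apply/negP => /(fs p q I I).
  by rewrite lt_min => /andP[_]; rewrite ltNge PQ.
have [d' d'0 fd] := compact_unif_cts f d fX.1 cf d0.
exists (f @^-1` A), (f @^-1` B); split.
- by split; apply: open_comp => // y _; exact: cf.
- by move=> p Pp; apply: PA; exists p.
- by move=> q Qq; apply: QB; exists q.
- exists d' => // p q Ap Bq; rewrite leNgt; apply/negP => /fd.
  by rewrite ltNge AB.
have fe y z : `|f y - f z| < s -> mdist y z < e.
  by move=> /(fs y z I I); rewrite lt_min => /andP[].
move=> L M x LMx Ax Bx; have [[a Aa ax] [b Bb bx]] := near_AB _ Ax Bx.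
have [u LMu fu] := fine_map_spans e s f L M x a cf s0 fe LMx ax.
have [v LMv fv] := fine_map_spans e s f L M x b cf s0 fe LMx bx.
by split; [exists u|exists v]; split=> //=; rewrite ?fu ?fv.
Qed.

(** * Pierced open sets *)

Lemma compact_mdist_gt0 {R : realType} {X : metricType R} (K : set X) (a : X) :
  compact K -> ~ K a -> exists2 e, 0 < e & forall m, K m -> e <= mdist a m.
Proof.
move=> cK Ka; have : nbhs a (~` K).
  apply: open_nbhs_nbhs; split=> //.
  exact: closed_openC (compact_closed (@metric_hausdorff _ X) cK).
move=> /nbhs_ballP[e /= e0 eK]; exists e => // m Km.
by rewrite leNgt; apply/negP => am; apply: (eK m) => //; rewrite ballEmdist.
Qed.

(** The two halves [f @` `[t - c, t]] and [f @` `[t, t + c]] of a short subarc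
    around [x = f t] are compact and meet only in [x], so the outer end of each
    has a positive distance to the other. *)
Lemma arc_spans {R : realType} {X : metricType R} (A V : set X) (x : X) :
  is_arc R A -> goes_through R A x -> open V -> V x ->
  exists e L M, [/\ 0 < e, spans e L M x & L `|` M `<=` A `&` V].
Proof.
move=> [f hf] [Ax ne] oV Vx.
have [[fA finj fsurj] cf _] := hf.
have [t t01 ft] := fsurj _ Ax; have := t01; rewrite /= in_itv/= => /andP[t0 t1].
have {}t0 : 0 < t.
  rewrite lt_neqAle t0 andbT; apply/eqP => t0'; apply: ne.
  by exists f => //; left; rewrite -ft -t0'.
have {}t1 : t < 1.
  rewrite lt_neqAle t1 andbT; apply/eqP => t1'; apply: ne.
  by exists f => //; right; rewrite -ft t1'.
have [d d0 dV] : exists2 d, 0 < d & forall s, `|s - t| < d -> 0 <= s <= 1 -> V (f s).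
  have Vft : nbhs (f t) V by rewrite ft; exact: open_nbhs_nbhs.
  move/subspace_continuousP : cf => /(_ _ t01 V Vft).
  move=> /nbhs_ballP[d /= d0 dV]; exists d => // s sd s01.
  by apply: (dV s) => //; rewrite /ball/= distrC.
pose c := Num.min (d / 2) (Num.min t (1 - t)).
have c0 : 0 < c by rewrite !lt_min; apply/and3P; split; lra.
have [cd ct c1] : [/\ c <= d / 2, c <= t & c <= 1 - t].
  by split; rewrite /c !ge_min lexx ?orbT.
have sub u v : t - c <= u -> v <= t + c -> `[u, v] `<=` (`[0, 1] : set R).
  by move=> tu vt s; rewrite /= !in_itv/= => suv; lra.
have cpt u v : t - c <= u -> v <= t + c -> compact (f @` `[u, v]).
  move=> tu vt; apply: continuous_compact; last exact: segment_compact.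
  exact: continuous_subspaceW (sub _ _ tu vt) cf.
have cnt u v : t - c <= u -> v <= t + c -> connected (f @` `[u, v]).
  move=> tu vt; apply: connected_continuous_connected; first exact: segment_connected.
  exact: continuous_subspaceW (sub _ _ tu vt) cf.
have AV u v : t - c <= u -> v <= t + c -> f @` `[u, v] `<=` A `&` V.
  move=> tu vt _ [s suv <-]; have s01 := sub _ _ tu vt _ suv.
  split; first exact: fA.
  move: suv s01; rewrite /= !in_itv/= => suv s01.
  by apply: dV => //; rewrite ltr_norml; lra.
have out s u v : t - c <= u -> v <= t + c -> 0 <= s <= 1 -> ~ (u <= s <= v) ->
    ~ (f @` `[u, v]) (f s).
  move=> tu vt s01 suv [s' s'uv] /finj; rewrite !inE => ss'; apply: suv.
  have <- : s' = s by apply: ss'; [exact: (sub _ _ tu vt)|rewrite /= in_itv].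
  by move: s'uv; rewrite /= in_itv.
have [e e0 eP] : exists2 e, 0 < e &
    forall m, (f @` `[t, t + c]) m -> e <= mdist (f (t - c)) m.
  by apply: compact_mdist_gt0; [apply: cpt|apply: out]; lra.
have [e' e'0 e'P] : exists2 e, 0 < e &
    forall l, (f @` `[t - c, t]) l -> e <= mdist (f (t + c)) l.
  by apply: compact_mdist_gt0; [apply: cpt|apply: out]; lra.
exists (Num.min e e'), (f @` `[t - c, t]), (f @` `[t, t + c]); split.
- by rewrite lt_min e0.
- split; [apply: cnt; lra|apply: cnt; lra| | |].
  + by exists t => //; rewrite /= in_itv/=; lra.
  + by exists t => //; rewrite /= in_itv/=; lra.
  exists (f (t - c)), (f (t + c)); split.
  + by exists (t - c) => //; rewrite /= in_itv/=; lra.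
  + by exists (t + c) => //; rewrite /= in_itv/=; lra.
  + by move=> m /eP; rewrite ge_min => ->.
  + by move=> l /e'P; rewrite ge_min orbC => ->.
- by rewrite subUset; split; apply: AV; lra.
Qed.

(** The stages treat the sizes [1 / (n + 1)] one after the other.  A boundary
    point of the union [U] of the first sets is undecided at every stage, and a
    short arc around it is long enough for some stage. *)
Lemma pierced_between {R : realType} {X : metricType R} (r : R) (P Q : set X) :
  is_fence X -> 0 < r -> far_apart r P Q ->
  exists U, [/\ pierced R U, P `<=` U & U `&` Q = set0].
Proof.
move=> fX r0 PQ.
pose state := {PQ : set X * set X | exists2 r, 0 < r & far_apart r PQ.1 PQ.2}.
have /choice[next nextP] : forall ns : nat * state, exists s' : state,
    [/\ open (sval s').1 /\ open (sval s').2,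
      (sval ns.2).1 `<=` (sval s').1, (sval ns.2).2 `<=` (sval s').2 &
      forall L M x, spans ns.1.+1%:R^-1 L M x -> ~ (sval s').1 x -> ~ (sval s').2 x ->
        (L `|` M) `&` (sval s').1 !=set0 /\ (L `|` M) `&` (sval s').2 !=set0].
  move=> [n [[P1 Q1] /= [r1 r10 PQ1]]].
  have n0 : 0 < n.+1%:R^-1 :> R by rewrite invr_gt0 ltr0n.
  have [P' [Q' [oPQ PP' QQ' PQ' sP]]] := refine_far_apart _ _ _ _ fX n0 r10 PQ1.
  by exists (exist _ (P', Q') PQ').
pose fix stage n : state := if n is m.+1 then next (m, stage m)
  else exist _ (P, Q) (ex_intro2 _ _ r r0 PQ).
pose Pn n := (sval (stage n)).1; pose Qn n := (sval (stage n)).2.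
have stepP n : [/\ open (Pn n.+1) /\ open (Qn n.+1), Pn n `<=` Pn n.+1,
    Qn n `<=` Qn n.+1 & forall L M x, spans n.+1%:R^-1 L M x ->
      ~ Pn n.+1 x -> ~ Qn n.+1 x ->
      (L `|` M) `&` Pn n.+1 !=set0 /\ (L `|` M) `&` Qn n.+1 !=set0].
  exact: (nextP (n, stage n)).
have incr n m : (n <= m)%N -> Pn n `<=` Pn m /\ Qn n `<=` Qn m.
  elim: m => [|m IHm]; first by rewrite leqn0 => /eqP ->; split.
  rewrite leq_eqVlt => /orP[/eqP ->|/IHm[Pnm Qnm]]; first by split.
  have [_ PS QS _] := stepP m.
  by split; [exact: subset_trans PS|exact: subset_trans QS].
have disj n m y : Pn n y -> Qn m y -> False.
  move=> Pny Qmy.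
  have Py := (incr _ _ (leq_maxl n m)).1 _ Pny.
  have Qy := (incr _ _ (leq_maxr n m)).2 _ Qmy.
  have [s s0 far] := svalP (stage (maxn n m)).
  by have := far _ _ Py Qy; rewrite mdistxx; lra.
(* The stages from 1 on consist of open sets. *)
pose U := \bigcup_n Pn n.+1; pose O := \bigcup_n Qn n.+1.
have oU : open U by apply: bigcup_open => n _; have [[]] := stepP n.
have oO : open O by apply: bigcup_open => n _; have [[]] := stepP n.
have OU y : O y -> ~ closure U y.
  move=> Oy /(_ O (open_nbhs_nbhs (conj oO Oy)))[z [[n _ Pz] [m _ Qz]]].
  exact: disj Pz Qz.
exists U; split; last 2 first.
- by move=> y Py; exists 0%N => //; exact: (incr 0%N 1%N isT).1.
- by rewrite -subset0 => y [[n _ Pny] Qy]; case: (disj n.+1 0%N y).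
split=> // x bx; split=> // V oV Vx A arcA Ax.
have [clx nx] := bx.
have notU : ~ U x by move=> Ux; apply: nx; exact: open_nbhs_nbhs.
have notO : ~ O x by move/OU; apply.
have [e [L [M [e0 LMx LMAV]]]] := arc_spans A V x arcA Ax oV Vx.
have [n ne] : exists n, n.+1%:R^-1 <= e.
  exists (Num.truncn e^-1); rewrite -[leRHS]invrK lef_pV2 ?posrE ?invr_gt0//.
  by apply/ltW; rewrite truncnS_gt.
have LMn : spans n.+1%:R^-1 L M x.
  have [cL cM Lx Mx [a [b [La Mb aM bL]]]] := LMx; split=> //.
  exists a, b; split=> // [m /aM|l /bL]; exact: le_trans.
have [_ _ _ /(_ _ _ _ LMn)[||]] := stepP n.
- by move=> Px; apply: notU; exists n.
- by move=> Qx; apply: notO; exists n.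
move=> [y [/LMAV AVy Py]] [z [/LMAV AVz Qz]].
split; first by exists y; split=> //; exists n.
by exists z; split=> //; apply: OU; exists n.
Qed.

Theorem theorem2 (R : realType) (X : metricType R) (hX : is_fence X) : jure_property R X.
Proof.
exists [set U | pierced R U] => //; split=> [U []//|x W].
move=> /nbhs_ballP[r /= r0 rW].
have far : far_apart r [set x] (~` ball x r).
  by move=> _ y -> /=; rewrite ballEmdist /= leNgt => /negP.
have [U [pU xU UW]] := pierced_between r _ _ hX r0 far.
exists U; first by split=> //; exact: xU.
move=> y Uy; apply: rW; apply: contrapT => yr.
by have : set0 y by rewrite -UW.
Qed.
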